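(* Let $T = (T_1,\ldots,T_n) \in \mathcal{B}(\mathcal{H})^n$ be a pure commuting contractive tuple on a Hilbert space $\mathcal{H}$ and let $\Pi_i : \mathcal{H} \to H^2_n(\mathcal{E}_i)$, $i = 1,2$, be a pair of minimal dilations of $T$. Then there exists a unitary operator $U \in \mathcal{B}(\mathcal{E}_1,\mathcal{E}_2)$ such that $$\Pi_2 = (I_{H^2_n} \otimes U)\,\Pi_1 .$$
   Context: All Hilbert spaces are complex; $\mathbb{N}$ contains $0$; $\mathcal{B}(\mathcal{E},\mathcal{F})$ denotes the bounded linear operators from $\mathcal{E}$ to $\mathcal{F}$. A commuting tuple $T=(T_1,\ldots,T_n)$ of bounded operators on $\mathcal{H}$ is a contractive tuple (row contraction) if $P_T(I_{\mathcal{H}}) \le I_{\mathcal{H}}$, where $P_T(X) = \sum_{i=1}^n T_i X T_i^*$ for $X \in \mathcal{B}(\mathcal{H})$. A row contraction is pure if $P_T^m(I_{\mathcal{H}}) \to 0$ in the strong operator topology as $m\to\infty$. $H^2_n$ is the Drury-Arveson space, i.e. the reproducing kernel Hilbert space of analytic functions on the open unit ball $\mathbb{B}^n \subset \mathbb{C}^n$ with kernel $(1-\sum_{i=1}^n z_i\bar w_i)^{-1}$. For a Hilbert space $\mathcal{E}$, $H^2_n(\mathcal{E})$ is the $\mathcal{E}$-valued reproducing kernel Hilbert space with kernel $(1-\sum_{i=1}^n z_i\bar w_i)^{-1} I_{\mathcal{E}}$, identified with $H^2_n \otimes \mathcal{E}$; $M_{z_i}$ denotes multiplication by the $i$-th coordinate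 function on it. An isometry $\Gamma : \mathcal{H} \to H^2_n(\mathcal{E})$, with $\mathcal{E}$ a Hilbert space, is a dilation of $T$ if $M_{z_i}^*\Gamma = \Gamma T_i^*$ for $i=1,\ldots,n$. A dilation $\Gamma$ is minimal if $H^2_n(\mathcal{E}) = \overline{\mathrm{span}}\{z^{k}\Gamma h : k \in \mathbb{N}^n, h \in \mathcal{H}\}$, where $z^k = z_1^{k_1}\cdots z_n^{k_n}$. *)

(* Defs.v *)
From HB Require Import structures.
From mathcomp Require Import all_boot all_order all_algebra.
From mathcomp Require Import sesquilinear.
From mathcomp Require Import complex.
From mathcomp Require Import boolp classical_sets reals topology normedtype.
From mathcomp Require Import sequences.

Set Implicit Arguments.
Unset Strict Implicit.
Unset Printing Implicit Defensive.

Import Order.TTheory GRing.Theory Num.Theory.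
Import numFieldNormedType.Exports.

Local Open Scope classical_set_scope.
Local Open Scope ring_scope.

(* Complex Hilbert spaces.  [{dot H for Num.conj}] is linear in its first      *)
(* argument and conjugate-linear in the second.                               *)
HB.mixin Record isHilbert (R : realType) H & CompleteNormedModule R[i] H := {
  dotH : {dot H for (@Num.conj R[i])};
  dotH_norm : forall x : H, dotH x x = `|x| ^+ 2
}.

#[short(type="hilbertType")]
HB.structure Definition Hilbert (R : realType) :=
  {H of CompleteNormedModule R[i] H & isHilbert R H}.

Notation "''[' x , y ]" := (dotH x y) : ring_scope.

(* The Hilbert space of scalars.  An alias of [R[i]^o] is needed to carry the  *)
(* instances, the library already using [_^o] as key for complete types.      *)
Definition scalarH (R : realType) := R[i]^o.

Section ComplexHilbert.
Variable R : realType.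
Local Notation C := R[i].

Lemma complexo_complete (F : set_system C^o) :
  ProperFilter F -> cauchy F -> cvg F.
Proof.
move=> FF /cauchyP Fc.
have part (p : C -> R) : (forall x y : C, `|p x - p y|%:C%C <= `|x - y|) ->
    exists a, forall e : R, 0 < e -> \forall x \near F, `|a - p x| < e.
  move=> pL; have /cauchy_cvgP/cvg_ex[a pa] : cauchy (p @ F).
    apply/cauchyP => e e0.
    have [|x Fx] := Fc e%:C%C; first by rewrite ltcR.
    exists (p x); change (F (p @^-1` ball (p x) e)); apply: filterS Fx => y xy.
    change (`|p x - p y| < e).
    by rewrite -ltcR; exact: le_lt_trans (pL _ _) xy.
  by exists a => e e0; move/cvgrPdist_lt : pa => /(_ e e0).
have normi : `|'i%C| = 1 :> C.
  by rewrite normc_def /= expr0n expr1n add0r sqrtr1.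
have [|a pa] := part (@complex.Re R).
  by move=> x y; rewrite -raddfB normc_ge_Re.
have [|b pb] := part (@complex.Im R).
  move=> x y; have := normc_ge_Re (- 'i%C * (x - y)).
  rewrite normrM normrN normi mul1r; apply: le_trans.
  by case: x y => [u v] [u' v'] /=; rewrite oppr0 mul0r mulN1r opprK add0r.
apply/cvg_ex; exists (a +i* b)%C; apply/cvgrPdist_lt => e e0.
have eE : e = (complex.Re e)%:C%C by rewrite RRe_real ?gtr0_real.
have e20 : 0 < complex.Re e / 2 by rewrite divr_gt0 // -ltcR -eE.
have normR (r : R) : `|r%:C%C| = `|r|%:C%C :> C.
  by rewrite normc_def /= expr0n addr0 sqrtr_sqr.
apply: filterS2 (pa _ e20) (pb _ e20) => -[u v] /= ua vb.
have := ltrD ua vb; rewrite -splitr -ltcR -eE; apply: le_lt_trans.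
rewrite [(a +i* b)%C - _]complexE /=; apply: le_trans (ler_normD _ _) _.
by rewrite normrM normi mul1r !normR -rmorphD.
Qed.

HB.instance Definition _ := NormedModule.copy (scalarH R) C^o.
HB.instance Definition _ :=
  Uniform_isComplete.Build (scalarH R) complexo_complete.

Definition dot_complex (x y : (scalarH R)) : C := x * Num.conj (y : C).

Let dot_complex_bilinear :
  bilinear_for ( *%R : C -> C -> C) (Num.conj \; *%R) dot_complex.
Proof.
split=> u a x y; rewrite /dot_complex /=.
  by rewrite mulrDl mulrA.
by rewrite rmorphD rmorphM /= mulrDr mulrCA.
Qed.

HB.instance Definition _ := bilinear_isBilinear.Build
  C (scalarH R) (scalarH R) C *%R (Num.conj \; *%R) dot_complex dot_complex_bilinear.

Let dot_complex_hermitian (x y : (scalarH R)) :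
  dot_complex x y = (-1) ^+ false * Num.conj (dot_complex y x).
Proof. by rewrite mul1r /dot_complex rmorphM /= conjCK mulrC. Qed.

HB.instance Definition _ := isHermitianSesquilinear.Build
  C (scalarH R) false Num.conj dot_complex dot_complex_hermitian.

Let dot_complex_gt0 (x : (scalarH R)) : x != 0 -> 0 < dot_complex x x.
Proof. by move=> x0; rewrite /dot_complex -normCK exprn_gt0 ?normr_gt0. Qed.

HB.instance Definition _ := isDotProduct.Build C (scalarH R) dot_complex dot_complex_gt0.

Let dot_complex_norm (x : (scalarH R)) : dot_complex x x = `|x| ^+ 2.
Proof. by rewrite /dot_complex -normCK. Qed.

HB.instance Definition _ := isHilbert.Build R (scalarH R) dot_complex_norm.

End ComplexHilbert.

Section Operators.
Variable R : realType.
Local Notation C := R[i].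
Implicit Types E F H : hilbertType R.

(* [adjoint A y] is the Riesz representative of [x |-> '[A x, y]]; it exists  *)
(* and is unique whenever [A] is linear and bounded.                          *)
Definition adjoint E F (A : E -> F) (y : F) : E :=
  xget 0 [set x' | forall x, '[A x, y] = '[x, x']].

Definition op_le H (A B : H -> H) := forall h : H, 0 <= '[B h - A h, h].

Definition is_isometry E F (A : {linear E -> F}) := forall x, `|A x| = `|x|.

Definition unitary_op E F (U : {linear E -> F}) :=
  [/\ continuous U, adjoint U \o U =1 id & U \o adjoint U =1 id].

Definition linear_span H (S : set H) : set H :=
  [set x | exists m (c : 'I_m -> C) (s : 'I_m -> H),
    (forall j, S (s j)) /\ x = \sum_j c j *: s j].

End Operators.

Section Tuples.
Variables (R : realType) (n : nat) (H : hilbertType R).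
Implicit Type T : 'I_n -> {linear H -> H}.

Definition commuting_tuple T :=
  (forall i, continuous (T i)) /\ (forall i j, T i \o T j =1 T j \o T i).

Definition P_map T (X : H -> H) : H -> H :=
  fun h => \sum_i T i (X (adjoint (T i) h)).

Definition row_contraction T := commuting_tuple T /\ op_le (P_map T id) id.

Definition pure_tuple T :=
  forall h : H, (iter m (P_map T) id h) @[m --> \oo] --> (0 : H).

End Tuples.

(* Reproducing kernel Hilbert spaces of [E]-valued functions on [X] with      *)
(* kernel [K(z, w) I_E]: a Hilbert space whose elements are, through the       *)
(* injection [ev], functions [X -> E], and which contains every function      *)
(* [K(., w) eta], these having the reproducing property.  Such a space is     *)
(* determined by [K] and [E] up to the unitary operator identifying equal     *)
(* functions; statements about it quantify over all its realizations.         *)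
Record rkhs (R : realType) (X : Type) (K : X -> X -> R[i]) (E : hilbertType R) :=
  RKHS {
    rkhs_space :> hilbertType R;
    ev : rkhs_space -> X -> E;
    ev_linear : forall z, linear (ev ^~ z);
    ev_inj : injective ev;
    ev_reproducing : forall (w : X) (eta : E),
      exists2 k : rkhs_space, (forall z, ev k z = K z w *: eta) &
        forall f : rkhs_space, '[f, k] = '[ev f w, eta]
  }.

Section RKHSOperators.
Variables (R : realType) (X : Type) (K : X -> X -> R[i]).
Local Notation C := R[i].
Implicit Type E : hilbertType R.

(* The values of [xget] below exist and are unique for the Drury-Arveson       *)
(* kernel, when [phi] is a polynomial and [U] is linear and bounded.           *)
Definition mul_op E (D : rkhs K E) (phi : X -> C) (f : D) : D :=
  xget 0 [set g : D | forall z, ev g z = phi z *: ev f z].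

(* The tensor product of the scalar space with [E] is identified with the     *)
(* [E]-valued space: [f (x) eta] is the function [z |-> f(z) eta].            *)
Definition pure_tensor (D0 : rkhs K (scalarH R)) E (D : rkhs K E)
    (f : D0) (eta : E) : D :=
  xget 0 [set g : D | forall z, ev g z = (ev f z : C) *: eta].

(* [I (x) U]: the bounded operator such that                                  *)
(* [(I (x) U) (f (x) eta) = f (x) U eta].                                     *)
Definition id_tensor (D0 : rkhs K (scalarH R)) E1 E2
    (D1 : rkhs K E1) (D2 : rkhs K E2) (U : E1 -> E2) : D1 -> D2 :=
  xget (fun=> 0) [set A : D1 -> D2 | [/\ linear A, continuous A &
    forall (f : D0) (eta : E1),
      A (pure_tensor D1 f eta) = pure_tensor D2 f (U eta)]].

End RKHSOperators.

Arguments id_tensor {R X K} D0 {E1 E2} D1 D2 U _.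

Section DruryArveson.
Variables (R : realType) (n : nat).
Local Notation C := R[i].

(* The open unit ball for the Euclidean norm (not for the library's norm on   *)
(* matrices, which is the sup norm).                                          *)
Definition unit_ball := {z : 'rV[C]_n | \sum_i `|z 0 i| ^+ 2 < 1}.

Definition coord (i : 'I_n) (z : unit_ball) : C := val z 0 i.

Definition monom (k : {ffun 'I_n -> nat}) (z : unit_ball) : C :=
  \prod_i coord i z ^+ k i.

Definition drury_arveson_kernel (z w : unit_ball) : C :=
  (1 - \sum_i coord i z * Num.conj (coord i w))^-1.

(* Its elements are automatically analytic functions on the ball.             *)
Definition drury_arveson (E : hilbertType R) := rkhs drury_arveson_kernel E.

Variables (H E : hilbertType R) (D : drury_arveson E).
Variables (T : 'I_n -> {linear H -> H}) (G : {linear H -> D}).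

Definition dilation := is_isometry G /\
  forall i, adjoint (mul_op (coord i) : D -> D) \o G =1 G \o adjoint (T i).

Definition minimal_dilation := dilation /\
  closure (linear_span [set g : D |
    exists (k : {ffun 'I_n -> nat}) (h : H), g = mul_op (monom k) (G h)]) = setT.

End DruryArveson.

(* Main.v *)
(* For a dilation [Gamma] one has [M_i^* Gamma h = Gamma (T_i^* h)], and the    *)
(* identity [I - \sum_i M_i M_i^* = (projection on the constants)] gives       *)
(* [|(Gamma h)(0)|^2 = |h|^2 - \sum_i |T_i^* h|^2].  This does not depend on    *)
(* [Gamma], so [(Pi_1 h)(0) |-> (Pi_2 h)(0)] is isometric; minimality makes    *)
(* both sets of values dense, whence a unitary [U].  The same identity reads   *)
(* [(Gamma h)(w) = (Gamma h)(0) + (Gamma S_w h)(w)] with                       *)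
(* [S_w = \sum_i w_i T_i^*], so that [U (Pi_1 h)(w) - (Pi_2 h)(w)] is           *)
(* unchanged when [h] is replaced with [S_w h]; it vanishes because [S_w] is   *)
(* a strict contraction.                                                      *)

From HB Require Import structures.
From mathcomp Require Import all_boot all_order all_algebra.
From mathcomp Require Import sesquilinear.
From mathcomp Require Import complex.
From mathcomp Require Import boolp classical_sets reals topology normedtype.
From mathcomp Require Import sequences.
From mathcomp Require Import ring.
Require Import Defs.

Set Implicit Arguments.
Unset Strict Implicit.
Unset Printing Implicit Defensive.

Import Order.TTheory GRing.Theory Num.Theory.
Import numFieldNormedType.Exports.

Local Open Scope classical_set_scope.
Local Open Scope ring_scope.

(** * Orthogonal projections in Hilbert spaces *)

(** Two minimal dilations are compared through their values at the origin. [norm_dilation_origin]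
    computes the norm of [(Pi h)(0)] from [T] and [h] alone, and [minimal_dense] makes these values
    dense, so the relation between [(Pi_1 h)(0)] and [(Pi_2 h)(0)] extends, by [unitary_extension],
    to a unitary [U]. [dilation_intertwining] carries the equality from the origin to every point of
    the ball, and [ev_id_tensor], by which [I (x) U] applies [U] pointwise, turns it into the
    equality of operators. All operators are built by one device: a linear relation with a norm
    bound, densely defined, is extended by closing its graph. Besides [U], this yields the backward
    shifts, from which the multiplications by coordinates are recovered as adjoints, and [I (x) U]
    itself. *)

Section HilbertSpace.
Variable R : realType.
Local Notation C := R[i].
Implicit Types H E F : hilbertType R.

Lemma dot_conjC H (x y : H) : '[x, y] = Num.conj '[y, x].
Proof. by rewrite (hermC dotH) mul1r. Qed.

Lemma dotr_eq H (x y : H) : (forall z, '[z, x] = '[z, y]) -> x = y.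
Proof.
move=> xy; apply/eqP; rewrite -subr_eq0 -(@dnorm_eq0 _ _ dotH).
by rewrite linearBr /= xy subrr.
Qed.

Lemma dotl_eq H (x y : H) : (forall z, '[x, z] = '[y, z]) -> x = y.
Proof.
by move=> xy; apply: dotr_eq => z; rewrite dot_conjC xy -dot_conjC.
Qed.

Lemma norm_sqrD H (x y : H) :
  `|x + y| ^+ 2 = `|x| ^+ 2 + `|y| ^+ 2 + ('[x, y] + Num.conj '[x, y]).
Proof. by rewrite -!dotH_norm dnormD. Qed.

Lemma norm_sqrB H (x y : H) :
  `|x - y| ^+ 2 = `|x| ^+ 2 + `|y| ^+ 2 - ('[x, y] + Num.conj '[x, y]).
Proof. by rewrite -!dotH_norm dnormB. Qed.

Lemma parallelogram H (x y : H) :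
  `|x + y| ^+ 2 + `|x - y| ^+ 2 = 2 * (`|x| ^+ 2 + `|y| ^+ 2).
Proof. by rewrite norm_sqrD norm_sqrB; ring. Qed.

(** Pythagoras after removing from [x] its component along [y]. It gives both Cauchy-Schwarz and the
    orthogonality of projections. *)
Lemma norm_sqr_residual H (x y : H) : y != 0 ->
  `|x - ('[x, y] / `|y| ^+ 2) *: y| ^+ 2
    = `|x| ^+ 2 - `|'[x, y]| ^+ 2 / `|y| ^+ 2.
Proof.
move=> y0; have yn0 : `|y| != 0 by rewrite normr_eq0.
have conj_norm : Num.conj (`|y| ^- 2) = `|y| ^- 2.
  by rewrite conj_Creal // rpredV rpredX ?normr_real.
rewrite norm_sqrB linearZr_LR /= normrZ normrM normfV normrX normr_id.
rewrite !rmorphM /= conjCK !conj_norm exprMn exprMn normCK.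
by field.
Qed.

Lemma CauchySchwarzH H (x y : H) : `|'[x, y]| <= `|x| * `|y|.
Proof.
have [->|y0] := eqVneq y 0; first by rewrite linear0r !normr0 mulr0.
have y20 : 0 < `|y| ^+ 2 by rewrite exprn_gt0 ?normr_gt0.
rewrite -(@ler_pXn2r _ 2) ?nnegrE ?mulr_ge0 // exprMn.
have := exprn_ge0 2 (normr_ge0 (x - ('[x, y] / `|y| ^+ 2) *: y)).
by rewrite norm_sqr_residual // subr_ge0 ler_pdivrMr.
Qed.

(** Polarization: [key] compares the real parts of the products, and [key] at ['i *: x] the
    imaginary parts. *)
Lemma isometry_dot E F (A : {linear E -> F}) :
  is_isometry A -> forall x y, '[A x, A y] = '[x, y].
Proof.
move=> A_iso x y.
have key u v : '[A u, A v] + Num.conj '[A u, A v] = '[u, v] + Num.conj '[u, v].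
  apply: (@addrI _ (`|u| ^+ 2 + `|v| ^+ 2)).
  by rewrite -norm_sqrD -(A_iso u) -(A_iso v) -(A_iso (u + v)) linearD norm_sqrD.
have := key x y; have := key ('i *: x) y.
rewrite linearZ /= !linearZl_LR /= !rmorphM /= !conjCi !mulNr -!mulrBr.
move=> /(mulfI (neq0Ci _)) im re.
apply: (@mulfI _ 2); rewrite ?pnatr_eq0 //.
have twice (p q : C) : 2 * p = (p + q) + (p - q) by ring.
by rewrite (twice _ (Num.conj '[A x, A y])) re im -twice.
Qed.

Lemma pos_lb2 (a b : C) : 0 < a -> 0 < b -> exists2 c, 0 < c & c <= a /\ c <= b.
Proof.
move=> a0 b0; case/orP: (real_leVge (gtr0_real a0) (gtr0_real b0)) => ab.
  by exists a.
by exists b.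
Qed.

(** Completeness for nested sets of shrinking diameter: the sets [S e] generate a Cauchy filter, and
    its limit [p] is approached inside each of them. *)
Lemma cauchy_family H (S : C -> set H) :
  (forall e, 0 < e -> S e !=set0) ->
  (forall e e', e <= e' -> S e `<=` S e') ->
  (forall e, 0 < e -> exists2 d, 0 < d &
     forall u v, S d u -> S d v -> `|u - v| < e) ->
  exists p, forall e d, 0 < e -> 0 < d -> exists2 u, S d u & `|u - p| < e.
Proof.
move=> S_n0 S_mono S_cauchy.
pose F : set_system H := [set A | exists2 e, 0 < e & S e `<=` A].
have FF : ProperFilter F.
  split; first by move=> [e e0 S0]; have [u /S0] := S_n0 _ e0.
  split=> [|A B [e e0 SA] [d d0 SB]|A B AB [e e0 SA]].
  - by exists 1.
  - have [c c0 [ce cd]] := pos_lb2 e0 d0; exists c => // x Sx.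
    by split; [exact/SA/(S_mono _ _ ce)|exact/SB/(S_mono _ _ cd)].
  - by exists e => //; exact: subset_trans AB.
have /cauchy_cvg/cvg_ex[p Fp] : cauchy F.
  apply/cauchy_exP => e /S_cauchy[d d0 Sd]; have [u Su] := S_n0 _ d0.
  by exists u, d => // v Sv; rewrite -ball_normE /=; exact: Sd.
exists p => e d e0 d0.
have [c c0 Sc] : F (ball p e) by apply: Fp; exact: nbhsx_ballx.
have [b b0 [bc bd]] := pos_lb2 c0 d0; have [u Su] := S_n0 _ b0.
exists u; first exact: (S_mono _ _ bd).
by have := Sc _ (S_mono _ _ bc _ Su); rewrite -ball_normE /= distrC.
Qed.

(** The subspace [M] may fail to be closed, so [p] is only a limit of points of [M]. Near-minimizers
    of the distance to [x] form a Cauchy family by the parallelogram law. *)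
Lemma exists_projection H (M : set H) (x : H) :
  M 0 -> (forall a u v, M u -> M v -> M (a *: u + v)) ->
  exists p, (forall e, 0 < e -> exists2 u, M u & `|u - p| < e) /\
            forall m, M m -> '[x - p, m] = 0.
Proof.
move=> M0 M_lin.
have MD u v : M u -> M v -> M (u + v).
  by move=> Mu Mv; rewrite -[u]scale1r; exact: M_lin.
have MZ a u : M u -> M (a *: u).
  by move=> Mu; rewrite -[_ *: _]addr0; exact: M_lin.
have normE (y : H) : (complex.Re `|y|)%:C%C = `|y| :> C.
  by rewrite RRe_real ?normr_real.
pose A := [set complex.Re `|x - u| | u in M].
have A_lb : lbound A 0.
  by move=> _ [u _ <-]; rewrite -ler0c normE.
have A_inf : has_inf A by split; [exists (complex.Re `|x - 0|), 0|exists 0].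
pose d : C := (inf A)%:C%C.
have d_le u : M u -> d <= `|x - u|.
  move=> Mu; rewrite -normE lecR; apply: ge_inf; first by exists 0.
  by exists u.
have d_ge0 : 0 <= d by rewrite ler0c; apply: lb_le_inf => //; case: A_inf.
pose S (e : C) := [set u | M u /\ `|x - u| < d + e].
have [|e e' ee' u [Mu ux]|e e0|p pS] := @cauchy_family _ S.
- move=> e e0.
  have eE : e = (complex.Re e)%:C%C by rewrite RRe_real ?gtr0_real.
  have [|_ [u Mu <-] ux] := @inf_adherent _ A (complex.Re e) _ A_inf.
    by rewrite -ltcR -eE.
  by exists u; split=> //; rewrite -normE eE -rmorphD ltcR.
- by split=> //; apply: lt_le_trans ux _; rewrite lerD2l.
- have d1 : 0 < 4 * (2 * d + 1) by rewrite mulr_gt0 // ltr_wpDl // mulr_ge0.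
  (* The parallelogram law will give [|u - v|^2 < 4 t (2 d + t)], which is at most [e^2] for this
     [t]. *)
  have [t t0 [t1 te]] := @pos_lb2 1 (e ^+ 2 / (4 * (2 * d + 1))) ltr01
    (divr_gt0 (exprn_gt0 2 e0) d1).
  exists t => // u v [Mu xu] [Mv xv].
  rewrite -(@ltr_pXn2r _ 2) ?nnegrE ?(ltW e0) //.
  have dt0 : 0 <= d + t by rewrite addr_ge0 // ltW.
  have -> : `|u - v| ^+ 2
      = 2 * (`|x - u| ^+ 2 + `|x - v| ^+ 2) - `|x + x - (u + v)| ^+ 2.
    have -> : x + x - (u + v) = (x - u) + (x - v) by rewrite opprD addrACA.
    rewrite -parallelogram [X in _ = X - _]addrC addrK opprB.
    by rewrite (addrC (x - u)) subrKA distrC.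
  have mid : 4 * d ^+ 2 <= `|x + x - (u + v)| ^+ 2.
    have -> : x + x - (u + v) = 2 *: (x - 2^-1 *: (u + v)).
      by rewrite scalerBr scalerA divff ?pnatr_eq0 // scale1r scaler_nat mulr2n.
    rewrite normrZ exprMn normr_nat -natrX ler_wpM2l // ler_pXn2r ?nnegrE //.
    exact/d_le/MZ/MD.
  have sq w : `|x - w| < d + t -> `|x - w| ^+ 2 < (d + t) ^+ 2.
    by move=> xw; rewrite ltr_pXn2r ?nnegrE.
  apply: (@lt_le_trans _ _ (2 * ((d + t) ^+ 2 + (d + t) ^+ 2) - 4 * d ^+ 2)).
    by apply: ltr_leB => //; rewrite ltr_pM2l // ltrD ?sq.
  have -> : 2 * ((d + t) ^+ 2 + (d + t) ^+ 2) - 4 * d ^+ 2 = t * (4 * (2 * d + t)).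
    by ring.
  move: te; rewrite ler_pdivlMr //; apply: le_trans.
  by rewrite ler_pM2l // ler_pM2l // lerD2l.
exists p; split=> [e e0|m Mm].
  by have [u [Mu _] up] := pS _ _ e0 e0; exists u.
have [->|m0] := eqVneq m 0; first by rewrite linear0r.
have xp : `|x - p| <= d.
  apply/ler_addgt0Pr => e e0; have e20 : 0 < e / 2 by rewrite divr_gt0.
  have [u [Mu xu] up] := pS _ _ e20 e20.
  rewrite -[x - p](subrKA u); apply: le_trans (ler_normD _ _) _.
  by rewrite [e]splitr addrA ltW // ltrD.
have dp u : M u -> d <= `|x - p - u|.
  move=> Mu; apply/ler_addgt0Pr => e e0.
  have [v [Mv xv] vp] := pS _ _ e0 e0; apply: le_trans (d_le _ (MD _ _ Mu Mv)) _.
  have -> : x - (u + v) = x - p - u - (v - p).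
    by rewrite opprB opprD -!addrA; congr (_ + _); rewrite addrCA addKr.
  by apply: le_trans (ler_normB _ _) _; rewrite lerD2l ltW.
have m20 : 0 < `|m| ^+ 2 by rewrite exprn_gt0 ?normr_gt0.
(* If ['[x - p, m]] were nonzero, removing from [x - p] its component along [m] would make it
   shorter than the distance [d]. *)
have := le_trans xp (dp _ (MZ ('[x - p, m] / `|m| ^+ 2) _ Mm)).
rewrite -(@ler_pXn2r _ 2) ?nnegrE // norm_sqr_residual // lerBrDr gerDl.
rewrite pmulr_lle0 ?invr_gt0 // => le0; apply/eqP.
by rewrite -normr_eq0 -sqrf_eq0 eq_le le0 exprn_ge0.
Qed.

End HilbertSpace.

(** * Adjoints and extensions of contractions *)

Section ContractionExtension.
Variable R : realType.
Local Notation C := R[i].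
Implicit Types H E F : hilbertType R.

Lemma dot_sum2 H (I J : Type) (s : seq I) (t : seq J) (a : I -> H) (b : J -> H) :
  '[\sum_(i <- s) a i, \sum_(j <- t) b j]
    = \sum_(i <- s) \sum_(j <- t) '[a i, b j].
Proof.
by rewrite linear_sumlz; apply: eq_bigr => i _; rewrite linear_sumr.
Qed.

(** The kernel of a bounded map is closed, since [f p = - f (u - p)] is arbitrarily small. Dividing
    by [c + 1] allows [c = 0]. *)
Lemma bounded_closure_eq0 H (V : normedZmodType C) (f : {additive H -> V})
    (c : C) (p : H) :
  0 <= c -> (forall x, `|f x| <= c * `|x|) ->
  (forall e, 0 < e -> exists2 u, f u = 0 & `|u - p| < e) -> f p = 0.
Proof.
move=> c0 f_bnd p_cl; apply/eqP; rewrite -normr_le0.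
apply/ler_addgt0Pr => e e0; rewrite add0r.
have c1 : 0 < c + 1 by rewrite ltr_wpDl.
have [u fu up] := p_cl _ (divr_gt0 e0 c1).
have -> : f p = - f (u - p) by rewrite raddfB fu sub0r opprK.
rewrite normrN (le_trans (f_bnd _)) //.
apply: (@le_trans _ _ ((c + 1) * `|u - p|)).
  by rewrite ler_wpM2r // lerDl.
by rewrite mulrC -ler_pdivlMr // ltW.
Qed.

Lemma riesz H (f : {scalar H}) (c : C) :
  0 <= c -> (forall x, `|f x| <= c * `|x|) ->
  exists y, forall x, f x = '[x, y].
Proof.
move=> c0 f_bnd; have [f0|/existsNP[x fx]] := pselect (forall x, f x = 0).
  by exists 0 => x; rewrite linear0r f0.
have [|a u v /= fu fv|p [pM p_orth]] := @exists_projection R H [set y | f y = 0] x.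
- exact: linear0.
- by rewrite linearP fu fv mulr0 addr0.
have fp : f p = 0 by exact: (@bounded_closure_eq0 _ _ f c).
set q := x - p in p_orth.
have fq : f q = f x by rewrite linearB fp subr0.
have q20 : '[q, q] != 0.
  by rewrite dnorm_eq0; apply: contra_notN fx => /eqP q0; rewrite -fq q0 linear0.
exists (Num.conj (f q / '[q, q]) *: q) => y.
rewrite linearZr_LR /= conjCK.
(* A vector of the kernel of [f], hence orthogonal to [q]; solving this orthogonality for [f y]
   gives the representation. *)
have /p_orth/eqP : f (f q *: y - f y *: q) = 0.
  by rewrite linearP linearN linearZ_LR /= mulrC subrr.
rewrite linearBr !linearZr_LR /= subr_eq0 => /eqP /(congr1 Num.conj).
rewrite !rmorphM /= !conjCK -!dot_conjC => e.
by rewrite mulrAC e mulfK.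
Qed.

Lemma adjoint_unique E F (A : E -> F) (y : F) (x' : E) :
  (forall x, '[A x, y] = '[x, x']) -> adjoint A y = x'.
Proof.
move=> Ax'; apply: xget_unique => // x'' Ax''.
by apply: dotr_eq => z; rewrite -Ax' -Ax''.
Qed.

Definition contractive E F (A : E -> F) := forall x, `|A x| <= `|x|.

Lemma adjointP E F (A : {linear E -> F}) : contractive A ->
  forall x y, '[A x, y] = '[x, adjoint A y].
Proof.
move=> A_le x y; pose f x := '[A x, y].
have f_lin : scalar f by move=> a u v; rewrite /f linearP linearPl.
pose fL : {scalar E} := HB.pack f (GRing.isLinear.Build _ _ _ _ f f_lin).
have [||z fz] := @riesz E fL `|y|; first exact: normr_ge0.
  move=> u; rewrite /= /f (le_trans (CauchySchwarzH _ _)) // mulrC.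
  by rewrite ler_wpM2l.
by rewrite (adjoint_unique fz) -fz.
Qed.

Lemma contractive_continuous E F (A : {linear E -> F}) :
  contractive A -> continuous A.
Proof.
move=> A_le; apply: bounded_linear_continuous; apply/linear_boundedP.
apply: (@filterS _ _ _ (fun r => 1 <= r)); last exact: nbhs_pinfty_ge.
by move=> r r1 x; rewrite (le_trans (A_le x)) // ler_peMl.
Qed.

Lemma continuous_dense_eq E F (A B : {linear E -> F}) (S : set E) :
  continuous A -> continuous B ->
  (forall x e, 0 < e -> exists2 u, S u & `|u - x| < e) ->
  (forall u, S u -> A u = B u) -> A =1 B.
Proof.
move=> A_cont B_cont S_dense AB x; pose D : {linear E -> F} := A \- B.
have /linear_bounded_continuous/linear_boundedP/pinfty_ex_gt0[c c0 D_bnd] :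
  continuous D by move=> y; apply: cvgB; [exact: A_cont|exact: B_cont].
apply/eqP; rewrite -subr_eq0; apply/eqP.
apply: (@bounded_closure_eq0 _ _ D c) => // [|e e0]; first exact: ltW.
by have [u /AB Su ux] := S_dense x e e0; exists u => //=; rewrite Su subrr.
Qed.

(** The closure of the graph of [G]. Relations are used because a vector may be a finite sum of
    kernel functions in several ways; the norm bound makes the image unique. *)
Definition closed_rel E F (G : E -> F -> Prop) (x : E) (y : F) :=
  forall e, 0 < e -> exists u v, [/\ G u v, `|u - x| < e & `|v - y| < e].

Lemma closed_rel_linear E F (G : E -> F -> Prop) :
  (forall a x y x' y', G x y -> G x' y' -> G (a *: x + x') (a *: y + y')) ->
  forall a x y x' y', closed_rel G x y -> closed_rel G x' y' ->
    closed_rel G (a *: x + x') (a *: y + y').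
Proof.
move=> G_lin a x y x' y' Gxy Gxy' e e0.
have a1 : 0 < `|a| + 1 by rewrite ltr_wpDl.
have [u [v [Guv ux vy]]] := Gxy _ (divr_gt0 (divr_gt0 e0 (ltr0Sn C 1)) a1).
have [u' [v' [Guv' ux' vy']]] := Gxy' _ (divr_gt0 e0 (ltr0Sn C 1)).
have close (V : hilbertType R) (z w z' w' : V) :
    `|w - z| < e / 2 / (`|a| + 1) -> `|w' - z'| < e / 2 ->
    `|a *: w + w' - (a *: z + z')| < e.
  move=> wz wz'; rewrite opprD addrACA -scalerBr [e]splitr.
  rewrite (le_lt_trans (ler_normD _ _)) // ler_ltD // normrZ.
  apply: (@le_trans _ _ ((`|a| + 1) * `|w - z|)).
    by rewrite ler_wpM2r // lerDl.
  by rewrite mulrC -ler_pdivlMr // ltW.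
by exists (a *: u + u'), (a *: v + v'); split; [exact: G_lin|exact: close..].
Qed.

Lemma closed_rel_le E F (G : E -> F -> Prop) :
  (forall x y, G x y -> `|y| <= `|x|) ->
  forall x y, closed_rel G x y -> `|y| <= `|x|.
Proof.
move=> G_le x y Gxy; apply/ler_addgt0Pr => e e0.
have [u [v [Guv ux vy]]] := Gxy _ (divr_gt0 e0 (ltr0Sn C 1)).
rewrite [e]splitr addrA -(subrKC v y) (le_trans (ler_normD _ _)) //.
rewrite lerD //; last by rewrite distrC ltW.
rewrite (le_trans (G_le _ _ Guv)) // -(subrKC x u).
by rewrite (le_trans (ler_normD _ _)) // lerD2l ltW.
Qed.

Lemma sub_closed_rel E F (G : E -> F -> Prop) x y : G x y -> closed_rel G x y.
Proof. by move=> Gxy e e0; exists x, y; rewrite !subrr !normr0. Qed.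

(** Two images of one vector differ by an image of [0], which the bound forces to vanish; hence any
    choice of images is linear. *)
Lemma linear_contractive_rel E F (P : E -> F -> Prop) :
  (forall a x y x' y', P x y -> P x' y' -> P (a *: x + x') (a *: y + y')) ->
  (forall x y, P x y -> `|y| <= `|x|) -> (forall x, exists y, P x y) ->
  exists B : {linear E -> F}, forall x, P x (B x).
Proof.
move=> P_lin P_le /choice[B PB].
have B_lin : linear B.
  move=> a x y; apply/eqP; rewrite -subr_eq0 -normr_le0.
  have := P_lin (- 1) _ _ _ _ (P_lin a _ _ _ _ (PB x) (PB y)) (PB (a *: x + y)).
  by rewrite !scaleN1r addNr => /P_le; rewrite normr0 [- _ + _]addrC.
pose BL : {linear E -> F} := HB.pack B (GRing.isLinear.Build _ _ _ _ B B_lin).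
by exists BL.
Qed.

Lemma closed_rel_extension E F (G : E -> F -> Prop) :
  (forall a x y x' y', G x y -> G x' y' -> G (a *: x + x') (a *: y + y')) ->
  (forall x y, G x y -> `|y| <= `|x|) ->
  (forall x e, 0 < e -> exists u v, G u v /\ `|u - x| < e) ->
  exists B : {linear E -> F}, forall x, closed_rel G x (B x).
Proof.
move=> G_lin G_le G_dense.
have GB x y x' y' : G x y -> G x' y' -> G (x - x') (y - y').
  by move=> Gx Gx'; rewrite (addrC x) (addrC y) -scaleN1r -(scaleN1r y'); exact: G_lin.
apply: linear_contractive_rel.
- exact: closed_rel_linear.
- exact: closed_rel_le.
move=> x.
pose S (e : C) : set F := [set v | exists2 u, G u v & `|u - x| < e].
have [|||p pS] := @cauchy_family _ _ S.
- by move=> e /(G_dense x)[u [v [Guv ux]]]; exists v, u.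
- by move=> e e' ee' v [u Guv ux]; exists u => //; exact: lt_le_trans ee'.
- move=> e e0; exists (e / 2) => [|v v' [u Guv ux] [u' Guv' ux']].
    by rewrite divr_gt0.
  rewrite (le_lt_trans (G_le _ _ (GB _ _ _ _ Guv Guv'))) //.
  by rewrite -(subrKA x) [e]splitr (le_lt_trans (ler_normD _ _)) // ltrD // distrC.
by exists p => e e0; have [v [u Guv ux] vp] := pS _ _ e0 e0; exists u, v.
Qed.

Lemma closed_rel_fun E F (G : E -> F -> Prop) :
  (forall a x y x' y', G x y -> G x' y' -> G (a *: x + x') (a *: y + y')) ->
  (forall x y, G x y -> `|y| <= `|x|) ->
  forall x y y', closed_rel G x y -> closed_rel G x y' -> y = y'.
Proof.
move=> G_lin G_le x y y' Gxy Gxy'.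
have /(closed_rel_le G_le) := closed_rel_linear G_lin (-1) Gxy' Gxy.
by rewrite !scaleN1r addNr normr0 normr_le0 addrC subr_eq0 => /eqP.
Qed.

Lemma contraction_extension E F (G : E -> F -> Prop) :
  (forall a x y x' y', G x y -> G x' y' -> G (a *: x + x') (a *: y + y')) ->
  (forall x y, G x y -> `|y| <= `|x|) ->
  (forall x e, 0 < e -> exists u v, G u v /\ `|u - x| < e) ->
  exists B : {linear E -> F}, contractive B /\ forall x y, G x y -> B x = y.
Proof.
move=> G_lin G_le G_dense.
have [B GB] := closed_rel_extension G_lin G_le G_dense.
exists B; split=> [x|x y /sub_closed_rel Gxy].
  exact: closed_rel_le G_le _ _ (GB x).
exact: closed_rel_fun G_lin G_le _ _ _ (GB x) Gxy.
Qed.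

(** [G] and its transpose are both extended. Their closed graphs are transposes of each other, so
    the two extensions are mutually inverse. *)
Lemma unitary_extension E F (G : E -> F -> Prop) :
  (forall a x y x' y', G x y -> G x' y' -> G (a *: x + x') (a *: y + y')) ->
  (forall x y, G x y -> `|y| = `|x|) ->
  (forall x e, 0 < e -> exists u v, G u v /\ `|u - x| < e) ->
  (forall y e, 0 < e -> exists u v, G u v /\ `|v - y| < e) ->
  exists (U : {linear E -> F}) (V : {linear F -> E}),
    [/\ is_isometry U, cancel U V, cancel V U & forall x y, G x y -> U x = y].
Proof.
move=> G_lin G_eq G_densel G_denser.
pose G' y x := G x y.
have G_le x y : G x y -> `|y| <= `|x| by move=> /G_eq ->.
have G'_le y x : G' y x -> `|x| <= `|y| by move=> /G_eq ->.
have G'_lin a y x y' x' : G' y x -> G' y' x' -> G' (a *: y + y') (a *: x + x').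
  by move=> Gxy Gxy'; exact: G_lin.
have [U GU] := closed_rel_extension G_lin G_le G_densel.
have [|V GV] := closed_rel_extension G'_lin G'_le.
  by move=> y e /(G_denser y)[u [v ?]]; exists v, u.
have swap x y : closed_rel G x y <-> closed_rel G' y x.
  by split=> Gxy e /Gxy[u [v [Guv ux vy]]]; exists v, u.
have Gfun := closed_rel_fun G_lin G_le; have G'fun := closed_rel_fun G'_lin G'_le.
exists U, V; split=> [x|x|y|x y /sub_closed_rel Gxy].
- apply/eqP; rewrite eq_le (closed_rel_le G_le (GU x)).
  exact: closed_rel_le G'_le _ _ ((swap _ _).1 (GU x)).
- exact: G'fun (GV (U x)) ((swap _ _).1 (GU x)).
- exact: Gfun (GU (V y)) ((swap _ _).2 (GV y)).
- exact: Gfun (GU x) Gxy.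
Qed.

End ContractionExtension.

(** * Reproducing kernel spaces *)

Section ReproducingKernel.
Variables (R : realType) (X : Type) (K : X -> X -> R[i]).
Local Notation C := R[i].
Implicit Type E : hilbertType R.

Definition kernel_fun E (D : rkhs K E) (w : X) (eta : E) : D :=
  projT1 (cid2 (ev_reproducing D w eta)).

Section OneSpace.
Variables (E : hilbertType R) (D : rkhs K E).
Local Notation k := (kernel_fun D).

Lemma ev_kernel w eta z : ev (k w eta) z = K z w *: eta.
Proof. by rewrite /kernel_fun; case: cid2. Qed.

Lemma dot_kernel (f : D) w eta : '[f, k w eta] = '[ev f w, eta].
Proof. by rewrite /kernel_fun; case: cid2. Qed.

Lemma dot_kernel2 w eta z zeta :
  '[k w eta, k z zeta] = K z w * '[eta, zeta].
Proof. by rewrite dot_kernel ev_kernel linearZl_LR. Qed.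

Lemma ev_ext (f g : D) : (forall z, ev f z = ev g z) -> f = g.
Proof. by move=> fg; apply: ev_inj; apply/funext. Qed.

Definition evL (z : X) : {linear D -> E} :=
  HB.pack (fun f : D => ev f z)
    (GRing.isLinear.Build _ _ _ _ (fun f : D => ev f z) (ev_linear z)).

Lemma evD f g z : ev (f + g : D) z = ev f z + ev g z.
Proof. exact: (linearD (evL z)). Qed.

Lemma evB f g z : ev (f - g : D) z = ev f z - ev g z.
Proof. exact: (linearB (evL z)). Qed.

Lemma evZ a f z : ev (a *: f : D) z = a *: ev f z.
Proof. exact: (linearZ_LR (evL z)). Qed.

Lemma ev_sum (I : Type) (s : seq I) (F : I -> D) z :
  ev (\sum_(i <- s) F i) z = \sum_(i <- s) ev (F i) z.
Proof. exact: (linear_sum (evL z)). Qed.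

Lemma kernel_linear w : linear (k w).
Proof.
move=> a x y; apply: ev_ext => z.
by rewrite ev_linear !ev_kernel scalerDr !scalerA mulrC.
Qed.

HB.instance Definition _ w :=
  GRing.isLinear.Build _ _ _ _ (k w) (kernel_linear w).

(** Cauchy-Schwarz for [f] and the kernel function at [z] with vector [ev f z], whose product is the
    square of the left side. *)
Lemma norm_ev_le (f : D) z : `|ev f z| <= sqrtC `|K z z| * `|f|.
Proof.
have [->|fz0] := eqVneq (ev f z) 0; first by rewrite normr0 mulr_ge0 // sqrtC_ge0.
rewrite -(ler_pM2r (x := `|ev f z|)) ?normr_gt0 //.
rewrite -expr2 -dotH_norm -dot_kernel (le_trans (real_ler_norm _)) //.
  by rewrite dot_kernel dotH_norm rpredX // normr_real.
rewrite (le_trans (CauchySchwarzH _ _)) // mulrAC mulrC ler_wpM2r //.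
rewrite -(@ler_pXn2r _ 2) ?nnegrE ?mulr_ge0 ?sqrtC_ge0 //.
rewrite exprMn sqrtCK -dotH_norm dot_kernel2 dotH_norm.
rewrite -[X in X <= _]ger0_norm; last by rewrite -dotH_norm -dot_kernel2 dnorm_ge0.
by rewrite normrM normrX normr_id.
Qed.

(* Finite sums of kernel functions carry no coefficients: these are absorbed   *)
(* in the vectors.                                                            *)
Lemma kernel_dense (f : D) e : 0 < e ->
  exists s : seq (X * E), `|\sum_(p <- s) k p.1 p.2 - f| < e.
Proof.
pose M := [set f : D | exists s : seq (X * E), f = \sum_(p <- s) k p.1 p.2].
have [||p [pM p_orth]] := @exists_projection R D M f.
- by exists [::]; rewrite big_nil.
- move=> a _ _ [s ->] [t ->].
  exists ([seq (p.1, a *: p.2) | p <- s] ++ t).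
  rewrite big_cat big_map scaler_sumr; congr (_ + _).
  by apply: eq_bigr => p _; rewrite linearZ.
suff -> : f = p by move=> /pM[_ [s ->] sp]; exists s.
apply/eqP; rewrite -subr_eq0; apply/eqP/ev_ext => z.
apply: dotl_eq => eta; rewrite -!dot_kernel linear0l.
by apply: p_orth; exists [:: (z, eta)]; rewrite big_seq1.
Qed.

End OneSpace.

(** * The operator [I (x) U] *)

Section Tensor.
Variables (E1 E2 : hilbertType R) (D1 : rkhs K E1) (D2 : rkhs K E2).
Variables (U : {linear E1 -> E2}) (V : {linear E2 -> E1}).
Hypotheses (U_iso : is_isometry U) (VK : cancel V U).
Local Notation k1 := (kernel_fun D1).
Local Notation k2 := (kernel_fun D2).

(** Since [U] preserves inner products, sending [k1 w eta] to [k2 w (U eta)] preserves the Gram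
    matrices of kernel functions, hence the norms of their finite sums. *)
Lemma tensor_extension : exists A : {linear D1 -> D2},
  is_isometry A /\ forall f z, ev (A f) z = U (ev f z).
Proof.
pose G (f : D1) (g : D2) := exists s : seq (X * E1),
  f = \sum_(p <- s) k1 p.1 p.2 /\ g = \sum_(p <- s) k2 p.1 (U p.2).
have [||f e e0|g e e0|A [B [A_iso _ _ GA]]] := @unitary_extension R D1 D2 G.
- move=> a _ _ _ _ [s [-> ->]] [t [-> ->]].
  exists ([seq (p.1, a *: p.2) | p <- s] ++ t).
  rewrite !big_cat !big_map !scaler_sumr.
  by split; congr (_ + _); apply: eq_bigr => p _; rewrite !linearZ.
- move=> _ _ [s [-> ->]]; apply/eqP.
  rewrite -(@eqrXn2 _ 2) // -!dotH_norm !dot_sum2; apply/eqP.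
  apply: eq_bigr => p _; apply: eq_bigr => q _.
  by rewrite !dot_kernel2 isometry_dot.
- have [s sf] := kernel_dense f e0.
  exists (\sum_(p <- s) k1 p.1 p.2), (\sum_(p <- s) k2 p.1 (U p.2)).
  by split=> //; exists s.
- have [s sg] := kernel_dense g e0.
  pose t := [seq (p.1, V p.2) | p <- s].
  exists (\sum_(p <- t) k1 p.1 p.2), (\sum_(p <- t) k2 p.1 (U p.2)); split.
    by exists t.
  rewrite big_map; apply: le_lt_trans sg; rewrite le_eqVlt; apply/orP; left.
  by apply/eqP; congr `|_ - _|; apply: eq_bigr => p _; rewrite /= VK.
exists A; split=> // f z; apply: dotl_eq => zeta.
have Ak : A (k1 z (V zeta)) = k2 z zeta.
  by apply: GA; exists [:: (z, V zeta)]; rewrite !big_seq1 /= VK.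
by rewrite -dot_kernel -Ak isometry_dot // dot_kernel -(isometry_dot U_iso) VK.
Qed.

End Tensor.

(** [id_tensor] is a chosen value: the operator [A] of [tensor_extension] meets its specification,
    and any other candidate agrees with [A] on kernel functions, which are elementary tensors with
    dense span. *)
Lemma ev_id_tensor (D0 : rkhs K (scalarH R)) E1 E2 (D1 : rkhs K E1)
    (D2 : rkhs K E2) (U : {linear E1 -> E2}) (V : {linear E2 -> E1}) :
  is_isometry U -> cancel U V -> cancel V U ->
  forall f z, ev (id_tensor D0 D1 D2 U f) z = U (ev f z).
Proof.
move=> U_iso UK VK f z.
have V_iso : is_isometry V by move=> y; rewrite -[in RHS](VK y) U_iso.
have [A [A_iso AE]] := tensor_extension D1 D2 U_iso VK.
have [B [B_iso BE]] := tensor_extension D2 D1 V_iso UK.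
have tensorE E (D : rkhs K E) (g : D0) eta (h : D) :
    (forall z, ev h z = (ev g z : C) *: eta) -> pure_tensor D g eta = h.
  by move=> gh; apply: xget_unique => // h' gh'; apply: ev_ext => y; rewrite gh gh'.
rewrite /id_tensor; case: xgetP => [T _ [T_lin T_cont T_tensor]|/(_ A)[]]; last first.
  split=> [||g eta].
  - exact: linearP.
  - by apply: contractive_continuous => x; rewrite A_iso.
  (* Either side of the next equation may be the default value [0] of          *)
  (* [pure_tensor]; the inverse [B] shows that both are then.                  *)
  - rewrite {1}/pure_tensor; case: xgetP => [h _ gh|no_h].
      by apply/esym/tensorE => y; rewrite AE gh linearZ.
    rewrite linear0 /pure_tensor; case: xgetP => // h _ gh.
    by have [] := no_h (B h); move=> y; rewrite BE gh linearZ /= UK.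
pose TL : {linear D1 -> D2} := HB.pack T (GRing.isLinear.Build _ _ _ _ T T_lin).
rewrite -AE; congr (ev _ z).
apply: (@continuous_dense_eq _ _ _ TL A
  [set f | exists s : seq (X * E1), f = \sum_(p <- s) kernel_fun D1 p.1 p.2]).
- exact: T_cont.
- by apply: contractive_continuous => x; rewrite A_iso.
- move=> x e /(kernel_dense x)[s sx].
  by exists (\sum_(p <- s) kernel_fun D1 p.1 p.2) => //; exists s.
move=> _ [s ->]; rewrite !linear_sum; apply: eq_bigr => -[w eta] _ /=.
have tensor_kernel E (D : rkhs K E) (xi : E) :
    pure_tensor D (kernel_fun D0 w 1) xi = kernel_fun D w xi.
  by apply: tensorE => y; rewrite !ev_kernel [_ *: 1]mulr1.
have -> : T (kernel_fun D1 w eta) = kernel_fun D2 w (U eta).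
  by rewrite -tensor_kernel T_tensor tensor_kernel.
by apply: ev_ext => y; rewrite AE !ev_kernel linearZ.
Qed.

End ReproducingKernel.

(** * Coordinate shifts on the Drury-Arveson space *)

Section DruryArvesonShift.
Variables (R : realType) (n : nat).
Local Notation C := R[i].
Local Notation ball := (unit_ball R n).
Local Notation K := (@drury_arveson_kernel R n).

Lemma sqr_amgm (a b : C) : 0 <= a -> 0 <= b -> 2 * (a * b) <= a ^+ 2 + b ^+ 2.
Proof.
move=> a0 b0; rewrite -subr_ge0.
have -> : a ^+ 2 + b ^+ 2 - 2 * (a * b) = (a - b) ^+ 2 by ring.
by rewrite real_exprn_even_ge0 // rpredB ?ger0_real.
Qed.

Lemma ball_dot_neq1 (z w : ball) :
  1 - \sum_i coord i z * Num.conj (coord i w) != 0.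
Proof.
apply/negP; rewrite subr_eq0 => /eqP zw1.
have : 2 * `|\sum_i coord i z * Num.conj (coord i w)| < 2.
  apply: (@le_lt_trans _ _ (\sum_i (`|coord i z| ^+ 2 + `|coord i w| ^+ 2))).
    apply: (@le_trans _ _ (2 * \sum_i `|coord i z * Num.conj (coord i w)|)).
      by rewrite ler_pM2l // ler_norm_sum.
    rewrite mulr_sumr; apply: ler_sum => i _.
    by rewrite normrM norm_conjC sqr_amgm.
  by rewrite big_split /= [ltRHS](_ : 2 = 1 + 1) // ltrD // ?(valP z) ?(valP w).
by rewrite -zw1 normr1 mulr1 ltxx.
Qed.

Lemma drury_arveson_kernelE (z w : ball) :
  K z w = 1 + \sum_i coord i z * Num.conj (coord i w) * K z w.
Proof.
rewrite -mulr_suml -[X in X = _](subrK (\sum_i coord i z * Num.conj (coord i w) * K z w)).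
by rewrite -mulr_suml -{1}[K z w]mul1r -mulrBl mulfV ?ball_dot_neq1.
Qed.

Lemma origin_subproof : \sum_i `|(0 : 'rV[C]_n) 0 i| ^+ 2 < 1.
Proof. by rewrite big1 // => i _; rewrite mxE normr0 expr0n. Qed.

Definition origin : ball := exist _ 0 origin_subproof.

Lemma coord_origin i : coord i origin = 0.
Proof. by rewrite /coord mxE. Qed.

Lemma kernel_originr z : K z origin = 1.
Proof.
rewrite /drury_arveson_kernel big1 ?subr0 ?invr1 // => i _.
by rewrite coord_origin conjC0 mulr0.
Qed.

Variables (E : hilbertType R) (D : drury_arveson n E).
Local Notation k := (kernel_fun D).

(* The identity [I - \sum_i M_i M_i^* = (projection on the constants)],         *)
(* before any [M_i] is known to exist.                                         *)
Lemma norm_kernel_sum (s : seq (ball * E)) :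
  `|\sum_(p <- s) k p.1 p.2| ^+ 2 = `|\sum_(p <- s) p.2| ^+ 2
    + \sum_i `|\sum_(p <- s) Num.conj (coord i p.1) *: k p.1 p.2| ^+ 2.
Proof.
rewrite -!dotH_norm !dot_sum2.
under [X in _ = _ + X]eq_bigr do rewrite -dotH_norm dot_sum2.
rewrite [X in _ = _ + X]exchange_big -big_split; apply: eq_bigr => p _ /=.
rewrite [X in _ = _ + X]exchange_big -big_split; apply: eq_bigr => q _ /=.
rewrite dot_kernel2 [in LHS]drury_arveson_kernelE mulrDl mul1r mulr_suml.
congr (_ + _); apply: eq_bigr => i _.
by rewrite linearZl_LR linearZr_LR /= conjCK dot_kernel2; ring.
Qed.

(** In [norm_kernel_sum] the [i]-th term is the squared norm of the image and the other terms are
    nonnegative, so the prescription is contractive. [B] is the future adjoint of multiplication by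
    [coord i]. *)
Lemma exists_backward_shift i : exists B : {linear D -> D},
  contractive B /\ forall w eta, B (k w eta) = Num.conj (coord i w) *: k w eta.
Proof.
pose G (f g : D) := exists s : seq (ball * E), f = \sum_(p <- s) k p.1 p.2 /\
  g = \sum_(p <- s) Num.conj (coord i p.1) *: k p.1 p.2.
have [|||B [B_le GB]] := @contraction_extension R D D G.
- move=> a _ _ _ _ [s [-> ->]] [t [-> ->]].
  exists ([seq (p.1, a *: p.2) | p <- s] ++ t).
  rewrite !big_cat !big_map !scaler_sumr.
  split; congr (_ + _); apply: eq_bigr => p _; rewrite [k _ (_ *: _)]linearZ //=.
  by rewrite !scalerA mulrC.
- move=> _ _ [s [-> ->]]; rewrite -(@ler_pXn2r _ 2) ?nnegrE //.
  rewrite norm_kernel_sum (bigD1 i) //= addrCA lerDl addr_ge0 ?exprn_ge0 //.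
  by apply: sumr_ge0 => j _; rewrite exprn_ge0.
- move=> f e /(kernel_dense f)[s sf]; exists (\sum_(p <- s) k p.1 p.2).
  exists (\sum_(p <- s) Num.conj (coord i p.1) *: k p.1 p.2).
  by split=> //; exists s.
exists B; split=> // w eta.
by apply: GB; exists [:: (w, eta)]; rewrite !big_seq1.
Qed.

Section BackwardShift.
Variables (i : 'I_n) (B : {linear D -> D}).
Hypothesis B_le : contractive B.
Hypothesis B_kernel : forall w eta, B (k w eta) = Num.conj (coord i w) *: k w eta.

Lemma dot_adjointl f g : '[adjoint B f, g] = '[f, B g].
Proof. by rewrite dot_conjC -(adjointP B_le) -dot_conjC. Qed.

Lemma ev_adjoint_shift f z : ev (adjoint B f) z = coord i z *: ev f z.
Proof.
apply: dotl_eq => eta; rewrite -dot_kernel dot_adjointl B_kernel.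
by rewrite linearZr_LR linearZl_LR /= conjCK dot_kernel.
Qed.

Lemma mul_op_coord f : mul_op (coord i) f = adjoint B f.
Proof.
apply: xget_unique; first exact: ev_adjoint_shift.
by move=> g gf; apply: ev_ext => z; rewrite gf ev_adjoint_shift.
Qed.

Lemma adjoint_mul_op_coord f : adjoint (mul_op (coord i) : D -> D) f = B f.
Proof. by apply: adjoint_unique => g; rewrite mul_op_coord dot_adjointl. Qed.

End BackwardShift.

Local Notation Mstar i := (adjoint (mul_op (coord i) : D -> D)).

Lemma adjoint_mul_op_coordP i (f g : D) :
  '[mul_op (coord i) f, g] = '[f, Mstar i g].
Proof.
have [B [B_le Bk]] := exists_backward_shift i.
by rewrite (mul_op_coord B_le Bk) (adjoint_mul_op_coord B_le Bk) dot_adjointl.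
Qed.

Lemma ev_mul_op_coord i (f : D) z : ev (mul_op (coord i) f) z = coord i z *: ev f z.
Proof.
have [B [B_le Bk]] := exists_backward_shift i.
by rewrite (mul_op_coord B_le Bk) (ev_adjoint_shift B_le Bk).
Qed.

Lemma ev_decomp (f : D) w :
  ev f w = ev f origin + \sum_i coord i w *: ev (Mstar i f) w.
Proof.
apply: dotl_eq => eta; rewrite linearDl /= linear_sumlz.
under eq_bigr do rewrite linearZl_LR /= -dot_kernel.
rewrite -!dot_kernel.
(* The recursion [drury_arveson_kernelE] read as an identity between functions of [z]; pairing it
   with [f] gives the decomposition. *)
have kE : k w eta = k origin eta
    + \sum_i Num.conj (coord i w) *: mul_op (coord i) (k w eta).
  apply: ev_ext => z; rewrite evD ev_sum !ev_kernel.
  rewrite {1}drury_arveson_kernelE scalerDl kernel_originr scaler_suml.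
  congr (_ + _); apply: eq_bigr => i _.
  rewrite evZ ev_mul_op_coord ev_kernel !scalerA.
  by congr (_ *: _); ring.
rewrite [in LHS]kE linearDr linear_sumr; congr (_ + _); apply: eq_bigr => i _.
by rewrite linearZr_LR /= conjCK dot_conjC adjoint_mul_op_coordP -dot_conjC.
Qed.

Lemma norm_ev_origin (f : D) :
  `|ev f origin| ^+ 2 = `|f| ^+ 2 - \sum_i `|Mstar i f| ^+ 2.
Proof.
(* The right side is the constant function [ev f origin], because the kernel is [1] at the
   origin. *)
have kE : f - \sum_i mul_op (coord i) (Mstar i f) = k origin (ev f origin).
  apply: ev_ext => z; rewrite evB ev_sum ev_kernel.
  rewrite kernel_originr scale1r [X in X - _]ev_decomp.
  under [X in _ - X]eq_bigr do rewrite ev_mul_op_coord.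
  by rewrite addrK.
rewrite -[LHS]dotH_norm -dot_kernel -kE linearBr /= dotH_norm linear_sumr.
congr (_ - _); apply: eq_bigr => i _.
by rewrite /= dot_conjC adjoint_mul_op_coordP -dot_conjC dotH_norm.
Qed.

End DruryArvesonShift.

(** * Dilations *)

Section Dilation.
Variables (R : realType) (n : nat) (H E : hilbertType R).
Variables (T : 'I_n -> {linear H -> H}) (D : drury_arveson n E).
Variable (G : {linear H -> D}).
Hypothesis G_dil : dilation T G.

Lemma norm_dilation_origin h :
  `|ev (G h) (origin R n)| ^+ 2 = `|h| ^+ 2 - \sum_j `|adjoint (T j) h| ^+ 2.
Proof.
have [G_iso G_adj] := G_dil; rewrite norm_ev_origin G_iso; congr (_ - _).
by apply: eq_bigr => j _; rewrite [adjoint _ _]G_adj /= G_iso.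
Qed.

Lemma dilation_decomp h w :
  ev (G h) w = ev (G h) (origin R n)
    + \sum_j coord j w *: ev (G (adjoint (T j) h)) w.
Proof.
have [_ G_adj] := G_dil; rewrite [LHS]ev_decomp; congr (_ + _).
by apply: eq_bigr => j _; rewrite [adjoint _ _]G_adj.
Qed.

(** Minimality approximates the constant function [eta] by sums of terms [z^k G h]. Evaluation at
    the origin is contractive and sends each term to a multiple of [ev (G h) origin]. *)
Lemma minimal_dense : minimal_dilation T G ->
  forall eta e, 0 < e -> exists h, `|ev (G h) (origin R n) - eta| < e.
Proof.
move=> [_ G_min] eta e e0.
have : closure (linear_span [set g : D |
    exists (k : {ffun 'I_n -> nat}) (h : H), g = mul_op (monom k) (G h)])
    (kernel_fun D (origin R n) eta) by rewrite G_min.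
move=> /(_ _ (nbhsx_ballx _ _ e0))[g [[m [c [s [sP ->]]]]]].
rewrite -ball_normE /= => gk.
have /choice[h hP] j : exists h, ev (c j *: s j) (origin R n) = ev (G h) (origin R n).
  have [k [h ->]] := sP j; rewrite evZ /mul_op.
  (* The default value [0] of [mul_op] is harmless here, so that               *)
  (* multiplication by monomials need not be shown to be well defined.         *)
  case: xgetP => [f _ ->|_].
    exists ((c j * monom k (origin R n)) *: h).
    by rewrite [G (_ *: _)]linearZ evZ scalerA.
  by exists 0; rewrite linear0 -(scale0r (0 : D)) evZ !scale0r scaler0.
exists (\sum_j h j); rewrite linear_sum ev_sum.
under eq_bigr do rewrite -hP.
rewrite -ev_sum distrC -[eta]scale1r -(kernel_originr (origin R n)) -(ev_kernel D).
rewrite -evB; apply: le_lt_trans gk.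
by rewrite (le_trans (norm_ev_le _ _)) // kernel_originr normr1 sqrtC1 mul1r.
Qed.

End Dilation.

(** * Uniqueness of minimal dilations *)

Section MainArgument.
Variable R : realType.
Local Notation C := R[i].

Lemma geometric_le_eq0 (x c r : C) : 0 <= x -> 0 <= c -> 0 <= r -> r < 1 ->
  (forall N, x <= c * r ^+ N) -> x = 0.
Proof.
have toR (y : C) : 0 <= y -> exists2 a, 0 <= a & y = a%:C%C.
  move=> y0; have yE : y = (complex.Re y)%:C%C by rewrite RRe_real ?ger0_real.
  by exists (complex.Re y) => //; rewrite -ler0c -yE.
move=> /toR[a a0 ->] /toR[b b0 ->] /toR[q q0 ->]; rewrite -[1]/(1%:C%C) ltcR => q1.
move=> le_geo; have {}le_geo N : a <= b * q ^+ N.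
  by rewrite -lecR rmorphM rmorphXn.
have [->//|an0] := eqVneq a 0.
have a_gt0 : 0 < a by rewrite lt_def an0.
have b1 : 0 < b + 1 by rewrite ltr_wpDl.
have q_cvg : (fun N => q ^+ N) @ \oo --> (0 : R) by apply: cvg_expr; rewrite ger0_norm.
have /cvgrPdist_lt/(_ _ (divr_gt0 a_gt0 b1))[N _ /(_ N (leqnn N))/=] := q_cvg.
rewrite sub0r normrN ger0_norm ?exprn_ge0 // ltr_pdivlMr // => qN.
have qb : b * q ^+ N <= q ^+ N * (b + 1).
  by rewrite mulrC ler_wpM2l ?exprn_ge0 // lerDl.
by have := le_lt_trans (le_trans (le_geo N) qb) qN; rewrite ltxx.
Qed.

(* AM-GM on each [|w_j| |h| |x_j|] avoids square roots and still yields a      *)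
(* factor smaller than 1.                                                     *)
Lemma row_shift_le n (H : hilbertType R) (w : unit_ball R n) (x : 'I_n -> H) (h : H) :
  \sum_j `|x j| ^+ 2 <= `|h| ^+ 2 ->
  `|\sum_j coord j w *: x j| <= (1 + \sum_j `|coord j w| ^+ 2) / 2 * `|h|.
Proof.
move=> row_le; have [h0|h0] := eqVneq `|h| 0.
  have x0 : \sum_j `|x j| ^+ 2 = 0.
    apply/eqP; rewrite eq_le sumr_ge0 ?andbT => [|j _]; last by rewrite exprn_ge0.
    by rewrite (le_trans row_le) // h0 expr0n.
  rewrite h0 mulr0 big1 ?normr0 // => j _.
  have /(_ j isT)/eqP := @psumr_eq0P _ _ _ _ (fun i _ => exprn_ge0 2 (normr_ge0 _)) x0.
  by rewrite sqrf_eq0 normr_eq0 => /eqP ->; rewrite scaler0.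
have h_gt0 : 0 < `|h| by rewrite lt_def h0 normr_ge0.
rewrite -(ler_pM2r h_gt0).
rewrite [leRHS](_ : _ = (1 + \sum_j `|coord j w| ^+ 2) * `|h| ^+ 2 / 2); last by field.
rewrite ler_pdivlMr //.
apply: (@le_trans _ _ (\sum_j ((`|coord j w| * `|h|) ^+ 2 + `|x j| ^+ 2))).
  rewrite mulrC [X in 2 * X]mulrC mulrA.
  apply: (@le_trans _ _ (2 * `|h| * \sum_j `|coord j w *: x j|)).
    by rewrite ler_wpM2l ?mulr_ge0 // ler_norm_sum.
  rewrite mulr_sumr; apply: ler_sum => j _.
  rewrite normrZ; have -> : 2 * `|h| * (`|coord j w| * `|x j|)
      = 2 * (`|coord j w| * `|h| * `|x j|) by ring.
  by rewrite sqr_amgm ?mulr_ge0.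
rewrite big_split /=.
under eq_bigr do rewrite exprMn.
by rewrite -mulr_suml mulrDl mul1r [leRHS]addrC lerD2l.
Qed.

Variables (n : nat) (H : hilbertType R) (T : 'I_n -> {linear H -> H}).

(** In the discrepancy [L] at [w] the values at the origin cancel, so [L x = L (S x)]. As [L] is
    bounded and [S] contracts by a factor [r < 1], iterating forces [L] to vanish. *)
Lemma dilation_intertwining (E1 E2 : hilbertType R) (D1 : drury_arveson n E1)
    (D2 : drury_arveson n E2) (G1 : {linear H -> D1}) (G2 : {linear H -> D2})
    (U : {linear E1 -> E2}) :
  dilation T G1 -> dilation T G2 -> is_isometry U ->
  (forall h, U (ev (G1 h) (origin R n)) = ev (G2 h) (origin R n)) ->
  forall h w, U (ev (G1 h) w) = ev (G2 h) w.
Proof.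
move=> G1_dil G2_dil U_iso UG h w.
pose L x := U (ev (G1 x) w) - ev (G2 x) w.
pose S x := \sum_j coord j w *: adjoint (T j) x.
have L_shift x : L x = L (S x).
  rewrite /L (dilation_decomp G1_dil) (dilation_decomp G2_dil) linearD UG.
  rewrite opprD addrACA subrr add0r !linear_sum !ev_sum linear_sum /=.
  rewrite -[in RHS]sumrN; congr (_ + _); apply: eq_bigr => j _.
    by rewrite [G1 (_ *: _)]linearZ evZ.
  by rewrite [G2 (_ *: _)]linearZ evZ.
pose c := sqrtC `|drury_arveson_kernel w w|.
have c0 : 0 <= c by rewrite sqrtC_ge0.
have L_le x : `|L x| <= 2 * c * `|x|.
  have [G1_iso _] := G1_dil; have [G2_iso _] := G2_dil.
  rewrite (le_trans (ler_normB _ _)) // U_iso mulr_natl mulrnAl mulr2n.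
  by rewrite lerD // (le_trans (norm_ev_le _ _)) // ?G1_iso ?G2_iso.
pose r : C := (1 + \sum_j `|coord j w| ^+ 2) / 2.
have r0 : 0 <= r by rewrite divr_ge0 ?addr_ge0 // sumr_ge0 // => j _; rewrite exprn_ge0.
have r1 : r < 1 by rewrite ltr_pdivrMr // mul1r [ltRHS](_ : 2 = 1 + 1) // ltrD2l (valP w).
have S_le x : `|S x| <= r * `|x|.
  (* The difference of the two sides of the row bound is the square of the norm of [(G1 x)(0)]. *)
  apply: row_shift_le; rewrite -subr_ge0 -(norm_dilation_origin G1_dil).
  by rewrite exprn_ge0.
have L_geo N x : `|L x| <= 2 * c * `|x| * r ^+ N.
  elim: N x => [|N IH] x; first by rewrite mulr1.
  rewrite L_shift (le_trans (IH _)) // exprS mulrA ler_wpM2r ?exprn_ge0 //.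
  by rewrite -[leRHS]mulrA ler_wpM2l ?mulr_ge0 // mulrC.
apply/eqP; rewrite -subr_eq0 -normr_eq0; apply/eqP.
by apply: geometric_le_eq0 r1 (L_geo ^~ h) => //; rewrite !mulr_ge0.
Qed.

Lemma minimal_dilation_unitary (E1 E2 : hilbertType R) (D1 : drury_arveson n E1)
    (D2 : drury_arveson n E2) (G1 : {linear H -> D1}) (G2 : {linear H -> D2}) :
  minimal_dilation T G1 -> minimal_dilation T G2 ->
  exists (U : {linear E1 -> E2}) (V : {linear E2 -> E1}),
    [/\ is_isometry U, cancel U V, cancel V U &
      forall h w, U (ev (G1 h) w) = ev (G2 h) w].
Proof.
move=> G1_min G2_min; have [G1_dil _] := G1_min; have [G2_dil _] := G2_min.
pose o := origin R n.
pose G u v := exists h, u = ev (G1 h) o /\ v = ev (G2 h) o.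
have [||u e e0|v e e0|U [V [U_iso UK VK UG]]] := @unitary_extension R E1 E2 G.
- move=> a _ _ _ _ [h [-> ->]] [h' [-> ->]]; exists (a *: h + h').
  by rewrite !linearP !evD !evZ.
- move=> _ _ [h [-> ->]]; apply/eqP; rewrite -(@eqrXn2 _ 2) //.
  by rewrite (norm_dilation_origin G1_dil) (norm_dilation_origin G2_dil).
- have [h hu] := minimal_dense G1_min u e0.
  by exists (ev (G1 h) o), (ev (G2 h) o); split=> //; exists h.
- have [h hv] := minimal_dense G2_min v e0.
  by exists (ev (G1 h) o), (ev (G2 h) o); split=> //; exists h.
exists U, V; split=> //; apply: dilation_intertwining => // h.
by apply: UG; exists h.
Qed.

End MainArgument.

Lemma unitary_op_of_isometry (R : realType) (E F : hilbertType R)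
    (U : {linear E -> F}) (V : {linear F -> E}) :
  is_isometry U -> cancel U V -> cancel V U -> unitary_op U.
Proof.
move=> U_iso UK VK.
have adjU : adjoint U =1 V.
  by move=> y; apply: adjoint_unique => x; rewrite -(isometry_dot U_iso) VK.
split=> [|x|y] /=; last 2 first.
- by rewrite adjU UK.
- by rewrite adjU VK.
by apply: contractive_continuous => x; rewrite U_iso.
Qed.

Theorem theorem3p1 (R : realType) (n : nat) (H : hilbertType R)
    (T : 'I_n -> {linear H -> H})
    (T_contractive : row_contraction T) (T_pure : pure_tuple T)
    (E1 E2 : hilbertType R)
    (H2 : drury_arveson n (scalarH R))
    (H2E1 : drury_arveson n E1) (H2E2 : drury_arveson n E2)
    (Pi1 : {linear H -> H2E1}) (Pi2 : {linear H -> H2E2})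
    (Pi1_min : minimal_dilation T Pi1) (Pi2_min : minimal_dilation T Pi2) :
  exists U : {linear E1 -> E2},
    unitary_op U /\ Pi2 =1 id_tensor H2 H2E1 H2E2 U \o Pi1.
Proof.
have [U [V [U_iso UK VK UPi]]] := minimal_dilation_unitary Pi1_min Pi2_min.
exists U; split; first exact: unitary_op_of_isometry UK VK.
move=> h; apply: ev_ext => z.
by rewrite /= (ev_id_tensor _ _ U_iso UK VK) UPi.
Qed.
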